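(* Let $(X,\mathcal{G})$ be a gauge space. For each $n\in\mathbb{N}$ and each continuous map $\varphi\colon X\to[0,1]^n$ define a metric on $X$ by $d_\varphi(x,y)=d_n(\varphi(x),\varphi(y))$, where $d_n(a,b)=\max_{1\le i\le n}|a_i-b_i|$, and let $\mathcal{G}_\beta$ be the gauge on $X$ consisting of all the metrics $d_\varphi$. Then $\mathcal{G}_\beta$ is totally bounded and topologically equivalent to $\mathcal{G}$.
   Context: A metric on a set $X$ is a function $d\colon X\times X\to[0,\infty)$ with $d(x,x)=0$, $d(x,y)=d(y,x)$ and $d(x,y)+d(y,z)\ge d(x,z)$ for all $x,y,z$ (so $d(x,y)=0$ with $x\ne y$ is allowed). Write $d\ge d'$ for pointwise inequality. A gauge on $X$ is a nonempty set $\mathcal{G}$ of metrics on $X$ such that for any $d_1,d_2\in\mathcal{G}$ there is $d_3\in\mathcal{G}$ with $d_3\ge d_1$ and $d_3\ge d_2$. A gauge space is a set $X$ with a gauge; the elements of the gauge are called gauge metrics or $X$-metrics. For nonempty $A,B\subseteq X$ put $d(A,B)=\inf_{a\in A,b\in B}d(a,b)$; write $A\approx B$ if $d(A,B)=0$ for all gauge metrics $d$; by convention $\emptyset\not\approx A$ for all $A$. Write $x\approx A$ for $\{x\}\approx A$. Two gauges on the same set $X$ are topologically equivalent if they induce the same relation $x\approx A$ between points $x\in X$ and subsets $A\subseteq X$. A function $f\colon X\to Y$ of gauge spaces is continuous if $x\approx A$ in $X$ implies $f(x)\approx f(A)$ in $Y$, for all $x\in X$, $A\subseteq X$. $B_d(x,\varepsilon)=\{y\in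 X: d(y,x)<\varepsilon\}$ for $\varepsilon>0$. A gauge space $X$ is totally bounded if for any $X$-metric $d$ and any $\varepsilon>0$, $X$ is a union of finitely many balls $B_d(x_i,\varepsilon)$. The space $[0,1]^n$ carries the gauge $\{d_n\}$. *)

(* Defs.v *)
From HB Require Import structures.
From mathcomp Require Import all_boot all_order all_algebra.
From mathcomp Require Import boolp classical_sets functions cardinality.
From mathcomp Require Import reals interval_inference.

Set Implicit Arguments.
Unset Strict Implicit.
Unset Printing Implicit Defensive.

Import Order.TTheory GRing.Theory Num.Theory.

Local Open Scope classical_set_scope.
Local Open Scope ring_scope.

(* Distinct points may be at distance 0. *)
Definition is_metric (R : realType) (X : Type) (d : X -> X -> R) : Prop :=
  [/\ forall x y, 0 <= d x y,
      forall x, d x x = 0,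
      forall x y, d x y = d y x
    & forall x y z, d x z <= d x y + d y z].

Definition is_gauge (R : realType) (X : Type) (G : set (X -> X -> R)) : Prop :=
  [/\ G !=set0,
      forall d, G d -> is_metric d
    & forall d1 d2, G d1 -> G d2 -> exists d3,
        [/\ G d3, forall x y, d1 x y <= d3 x y & forall x y, d2 x y <= d3 x y]].

Definition set_dist (R : realType) (X : Type) (d : X -> X -> R)
    (A B : set X) : R :=
  inf [set d a b | a in A & b in B].

(* The nonemptiness conditions encode the convention that the empty set is
   near to nothing; they also keep [inf] away from its junk value at set0. *)
Definition near_sets (R : realType) (X : Type) (G : set (X -> X -> R))
    (A B : set X) : Prop :=
  [/\ A !=set0, B !=set0 & forall d, G d -> set_dist d A B = 0].

Definition topologically_equivalent (R : realType) (X : Type)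
    (G H : set (X -> X -> R)) : Prop :=
  forall (x : X) (A : set X), near_sets G [set x] A <-> near_sets H [set x] A.

Definition gauge_continuous (R : realType) (X Y : Type)
    (GX : set (X -> X -> R)) (GY : set (Y -> Y -> R)) (f : X -> Y) : Prop :=
  forall (x : X) (A : set X),
    near_sets GX [set x] A -> near_sets GY [set f x] (f @` A).

Definition metric_ball (R : realType) (X : Type) (d : X -> X -> R)
    (x : X) (e : R) : set X :=
  [set y | d y x < e].

Definition totally_bounded (R : realType) (X : Type)
    (G : set (X -> X -> R)) : Prop :=
  forall d, G d -> forall e : R, 0 < e ->
    exists F : set X,
      finite_set F /\ \bigcup_(x in F) metric_ball d x e = [set: X].

Definition cube (R : realType) (n : nat) : Type := 'I_n -> {i01 R}.

(* For n = 0 the maximum is 0, the only metric on the one-point cube. *)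
Definition cube_dist (R : realType) (n : nat) (a b : cube R n) : R :=
  \big[Num.max/0]_(i < n) `|(a i)%:num - (b i)%:num|.

Definition cube_gauge (R : realType) (n : nat) :
    set (cube R n -> cube R n -> R) :=
  [set @cube_dist R n].

Definition beta_gauge (R : realType) (X : Type) (G : set (X -> X -> R)) :
    set (X -> X -> R) :=
  [set d | exists (n : nat) (phi : X -> cube R n),
      gauge_continuous G (@cube_gauge R n) phi
      /\ d = (fun x y => cube_dist (phi x) (phi y))].

(* Main.v *)
Require Import Defs.
From mathcomp Require Import all_boot all_order all_algebra.
From mathcomp Require Import boolp classical_sets reals.
From mathcomp Require Import cardinality interval_inference lra.

(** Everything rests on two reformulations in terms of small distances: [x] is
    near [A] exactly when [A] has points arbitrarily close to [x] for each gauge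
    metric ([near_pointP]), and continuity into a space with one metric is the
    usual epsilon-delta condition with respect to some gauge metric
    ([gauge_continuousP]).

    - The metrics [d_phi] form a gauge: [d_phi] and [d_psi] are both dominated
      by the metric of the map [(phi, psi)] into the product cube.  That this
      map is continuous is where the directedness of [G] enters: the two
      continuity conditions at a point provide two gauge metrics, and a common
      upper bound of these serves for the pair.
    - It is totally bounded because [[0, 1]^n] is: dividing the cube into
      finitely many cells of side less than [e], and choosing a point of [X]
      over each cell that meets the image of [phi], yields finitely many centres.
    - It induces the same nearness.  Continuity of [phi] says precisely that
      nearness for [G] implies nearness for [d_phi].  Conversely, for [d] in [G]
      the map [y |-> min (1, d x y)] into the interval is continuous, and
      smallness of its variation from [x] to [a] is smallness of [d x a]. *)

Set Implicit Arguments.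
Unset Strict Implicit.
Unset Printing Implicit Defensive.

Import Order.TTheory GRing.Theory Num.Theory.

Local Open Scope classical_set_scope.
Local Open Scope ring_scope.

(** * Nearness and continuity by small distances *)

Lemma set_dist_pointP (R : realType) (X : Type) (d : X -> X -> R) (x : X)
    (A : set X) :
  (forall y, 0 <= d x y) -> A !=set0 ->
  set_dist d [set x] A = 0 <->
  forall e : R, 0 < e -> exists2 a, A a & d x a < e.
Proof.
move=> d0 [a0 Aa0]; rewrite /set_dist.
set S := (X in inf X).
have Sa a : A a -> S (d x a) by move=> Aa; exists x => //; exists a.
have lb0 : lbound S 0 by move=> _ [_ -> [a _ <-]].
have hS : has_inf S by split; [exists (d x a0); exact: Sa|exists 0].
split=> [S0 e e0|small].
  have [_ [_ -> [a Aa <-]]] := inf_adherent e0 hS.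
  by rewrite S0 add0r; exists a.
apply/eqP; rewrite eq_le lb_le_inf ?andbT; [|exact: hS.1|exact: lb0].
rewrite leNgt; apply/negP => /small [a Aa]; apply/negP; rewrite -leNgt.
by apply: ge_inf; [exact: hS.2|exact: Sa].
Qed.

Lemma near_pointP (R : realType) (X : Type) (G : set (X -> X -> R)) (x : X)
    (A : set X) :
  (forall d, G d -> forall y, 0 <= d x y) ->
  near_sets G [set x] A <->
  A !=set0 /\
  forall d, G d -> forall e : R, 0 < e -> exists2 a, A a & d x a < e.
Proof.
move=> G0; split=> [[_ A0 near]|[A0 near]].
  by split=> // d Gd; apply/(set_dist_pointP (G0 d Gd) A0); exact: near.
split=> [|//|d Gd]; first by exists x.
by apply/(set_dist_pointP (G0 d Gd) A0); exact: near.
Qed.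

(** For epsilon-delta from continuity: if the condition failed at [x] for [e], then [x] would be near the set of
    points whose images are at distance at least [e] from the image of [x]. *)
Lemma gauge_continuousP (R : realType) (X Y : Type) (G : set (X -> X -> R))
    (dY : Y -> Y -> R) (f : X -> Y) :
  G !=set0 -> (forall d, G d -> forall x y, 0 <= d x y) ->
  (forall x y, 0 <= dY x y) ->
  gauge_continuous G [set dY] f <->
  forall x (e : R), 0 < e -> exists d r,
    [/\ G d, 0 < r & forall y, d x y < r -> dY (f x) (f y) < e].
Proof.
move=> [d0 Gd0] G0 dY0.
have nearX x A := near_pointP (x := x) A (fun d Gd => G0 d Gd x).
split=> [cf x e e0|small x A /nearX [A0 near]].
  apply: contrapT => no.
  pose A := [set y | e <= dY (f x) (f y)].
  have close d r : G d -> 0 < r -> exists2 y, A y & d x y < r.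
    move=> Gd r0; apply: contrapT => far; apply: no; exists d, r.
    split=> // y dy.
    by rewrite ltNge; apply/negP => Ay; apply: far; exists y.
  have /cf /near_pointP [_ -> //|_ /(_ dY erefl e e0) [_ [y Ay <-]]] :
      near_sets G [set x] A.
    apply/nearX; split=> [|d Gd r r0]; last exact: close.
    by have [y Ay _] := close d0 1 Gd0 ltr01; exists y.
  by rewrite ltNge Ay.
apply/near_pointP => [_ -> //|]; split=> [|_ -> e e0].
  by case: A0 => a Aa; exists (f a), a.
have [d [r [Gd r0 dr]]] := small x e e0.
have [a Aa da] := near d Gd r r0.
by exists (f a); [exists a|exact: dr].
Qed.

(** * The metric of the cube *)

Lemma cube_dist_ltP (R : realType) (n : nat) (a b : cube R n) (e : R) :
  0 < e ->
  cube_dist a b < e <-> forall i, `|(a i)%:num - (b i)%:num| < e.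
Proof.
move=> e0; split=> [ab i|ab]; last by apply: bigmax_lt => // i _; exact: ab.
by apply: le_lt_trans ab; exact: (@le_bigmax _ _ _ 0 _ i).
Qed.

Lemma cube_dist_leP (R : realType) (n : nat) (a b : cube R n) (e : R) :
  0 <= e ->
  cube_dist a b <= e <-> forall i, `|(a i)%:num - (b i)%:num| <= e.
Proof.
move=> e0; split=> [ab i|ab]; last by apply: bigmax_le => // i _; exact: ab.
by apply: le_trans ab; exact: (@le_bigmax _ _ _ 0 _ i).
Qed.

Lemma cube_dist_metric (R : realType) (n : nat) : is_metric (@cube_dist R n).
Proof.
have ge0 (a b : cube R n) : 0 <= cube_dist a b by exact: bigmax_ge_id.
have coord (a b : cube R n) : forall i, `|(a i)%:num - (b i)%:num| <= _ :=
  (cube_dist_leP a b (ge0 a b)).1 (lexx _).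
split=> // [a|a b|a b c].
- apply/eqP; rewrite eq_le ge0 andbT; apply/cube_dist_leP => // i.
  by rewrite subrr normr0.
- by apply: eq_bigr => i _; rewrite distrC.
- apply/cube_dist_leP => [|i]; first exact: addr_ge0.
  by apply: le_trans (ler_distD (b i)%:num _ _) _; exact: lerD.
Qed.

Lemma pullback_metric (R : realType) (X Y : Type) (d : Y -> Y -> R)
    (f : X -> Y) :
  is_metric d -> is_metric (fun x y => d (f x) (f y)).
Proof. by case=> d0 dxx dC dD; split=> * //; exact: dD. Qed.

(** * Products of maps make the new gauge directed *)

Lemma cube_continuousP (R : realType) (X : Type) (G : set (X -> X -> R))
    (n : nat) (phi : X -> cube R n) :
  is_gauge G ->
  gauge_continuous G (@cube_gauge R n) phi <->
  forall x (e : R), 0 < e -> exists d r,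
    [/\ G d, 0 < r & forall y, d x y < r -> cube_dist (phi x) (phi y) < e].
Proof.
case=> G_ne G_metric _; apply: gauge_continuousP => // [d /G_metric [] //|].
by case: (cube_dist_metric R n).
Qed.

Definition cube_pair (R : realType) (m n : nat) (a : cube R m) (b : cube R n) :
    cube R (m + n) :=
  fun i => match split i with inl j => a j | inr j => b j end.

Lemma cube_pair_dist (R : realType) (m n : nat) (a a' : cube R m)
    (b b' : cube R n) :
  cube_dist (cube_pair a b) (cube_pair a' b') =
  Num.max (cube_dist a a') (cube_dist b b').
Proof.
have [m0 _ _ _] := cube_dist_metric R m.
have [n0 _ _ _] := cube_dist_metric R n.
have [mn0 _ _ _] := cube_dist_metric R (m + n).
have pair_coord :=
  (cube_dist_leP (cube_pair a b) (cube_pair a' b') (mn0 _ _)).1 (lexx _).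
apply/eqP; rewrite eq_le ge_max; apply/and3P; split.
- apply/cube_dist_leP => [|i]; first by rewrite le_max m0.
  rewrite /cube_pair; case: (split i) => j; rewrite le_max; apply/orP.
    by left; move: j; apply/cube_dist_leP.
  by right; move: j; apply/cube_dist_leP.
- apply/cube_dist_leP => // j.
  have := pair_coord (lshift n j).
  by rewrite /cube_pair -/(unsplit (inl j)) unsplitK.
- apply/cube_dist_leP => // j.
  have := pair_coord (rshift m j).
  by rewrite /cube_pair -/(unsplit (inr j)) unsplitK.
Qed.

Lemma cube_pair_continuous (R : realType) (X : Type) (G : set (X -> X -> R))
    (m n : nat) (phi : X -> cube R m) (psi : X -> cube R n) :
  is_gauge G ->
  gauge_continuous G (@cube_gauge R m) phi ->
  gauge_continuous G (@cube_gauge R n) psi ->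
  gauge_continuous G (@cube_gauge R (m + n))
    (fun x => cube_pair (phi x) (psi x)).
Proof.
move=> gG /(cube_continuousP _ gG) cphi /(cube_continuousP _ gG) cpsi.
apply/(cube_continuousP _ gG) => x e e0.
have [d1 [r1 [Gd1 r10 close1]]] := cphi x e e0.
have [d2 [r2 [Gd2 r20 close2]]] := cpsi x e e0.
have [_ _ directed] := gG; have [d [Gd d1d d2d]] := directed _ _ Gd1 Gd2.
exists d, (Num.min r1 r2); split=> [//||y].
  by rewrite lt_min r10.
rewrite lt_min cube_pair_dist gt_max => /andP[dr1 dr2].
by rewrite close1 ?close2 // ?(le_lt_trans (d1d _ _)) ?(le_lt_trans (d2d _ _)).
Qed.

Lemma beta_gauge_is_gauge (R : realType) (X : Type) (G : set (X -> X -> R)) :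
  is_gauge G -> is_gauge (beta_gauge G).
Proof.
move=> gG; have [[d0 Gd0] _ _] := gG; split.
- pose pt : cube R 0 := fun i => False_rect _ (notF (ltn_ord i)).
  exists (fun _ _ => cube_dist pt pt), 0, (fun=> pt); split=> //.
  apply/(cube_continuousP _ gG) => x e e0; exists d0, 1; split=> // y _.
  by have [_ -> _ _] := cube_dist_metric R 0.
- by move=> _ [n [phi [_ ->]]]; exact/pullback_metric/cube_dist_metric.
- move=> _ _ [m [phi [cphi ->]]] [n [psi [cpsi ->]]].
  exists (fun x y => cube_dist (cube_pair (phi x) (psi x))
                               (cube_pair (phi y) (psi y))); split.
  + exists (m + n), (fun x => cube_pair (phi x) (psi x)); split=> //.
    exact: cube_pair_continuous.
  + by move=> x y; rewrite cube_pair_dist le_max lexx.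
  + by move=> x y; rewrite cube_pair_dist le_max lexx orbT.
Qed.

(** * Total boundedness *)

(** Choosing a point in each nonempty fibre of a map to a finite type gives a
    finite set of centres as soon as the fibres have diameter less than [e]. *)
Lemma finite_fibres_cover (R : realType) (X : Type) (T : finType)
    (d : X -> X -> R) (c : X -> T) (e : R) :
  (forall x y, c x = c y -> d x y < e) ->
  exists F : set X, finite_set F /\ \bigcup_(x in F) metric_ball d x e = setT.
Proof.
move=> small.
have [[x0 _]|noX] := pselect (exists x : X, True); last first.
  exists set0; split=> //.
  by rewrite bigcup_set0; apply/seteqP; split=> x //= _; case: noX; exists x.
have /choice [s sP] : forall t : T, exists y, forall x, c x = t -> c y = t.
  move=> t; have [[y cy]|no] := pselect (exists y, c y = t).
    by exists y.
  by exists x0 => x cx; case: no; exists x.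
exists (range s); split; first exact/finite_image/finite_finset.
apply/seteqP; split=> // x _.
by exists (s (c x)); [exists (c x)|apply/small/esym/(sP _ x)].
Qed.

Lemma cube_totally_bounded (R : realType) (n : nat) (e : R) :
  0 < e -> exists (T : finType) (c : cube R n -> T),
    forall a b, c a = c b -> cube_dist a b < e.
Proof.
move=> e0.
pose k := Num.truncn e^-1.
have ek : e^-1 < k.+1%:R.
  by have /truncn_itv/andP[] : 0 <= e^-1 by rewrite invr_ge0 ltW.
have scale0 (t : {i01 R}) : 0 <= t%:num * k.+1%:R by rewrite mulr_ge0.
(* The coordinate 1 needs the extra cell with index [k.+1]. *)
have cell_lt (t : {i01 R}) : (Num.truncn (t%:num * k.+1%:R) < k.+2)%N.
  rewrite truncn_lt_nat //; apply: (@le_lt_trans _ _ k.+1%:R); last first.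
    by rewrite ltr_nat.
  by rewrite ler_piMl.
pose c (a : cube R n) := [ffun i => Ordinal (cell_lt (a i))].
exists {ffun 'I_n -> 'I_k.+2}, c => a b /ffunP ab; apply/cube_dist_ltP => // i.
have := ab i; rewrite !ffunE => /(congr1 val) /= {}ab.
have k0 : 0 < k.+1%:R :> R by rewrite ltr0n.
rewrite -(ltr_pM2r k0) -(gtr0_norm k0) -normrM mulrBl (gtr0_norm k0).
apply: (@lt_trans _ _ 1); last by rewrite mulrC -ltr_pdivrMr // div1r.
have := truncn_itv (scale0 (a i)); have := truncn_itv (scale0 (b i)).
rewrite {}ab; set m := Num.truncn _; rewrite -[m.+1%:R]natr1.
move=> /andP[lb ub] /andP[la ua].
by rewrite ltr_norml; apply/andP; split; lra.
Qed.

Lemma beta_gauge_totally_bounded (R : realType) (X : Type)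
    (G : set (X -> X -> R)) :
  totally_bounded (beta_gauge G).
Proof.
move=> _ [n [phi [_ ->]]] e /(cube_totally_bounded n) [T [c small]].
by apply: (@finite_fibres_cover _ _ _ _ (c \o phi)) => x y; exact: small.
Qed.

(** * Topological equivalence *)

Lemma min1_in_i01 (R : realType) (t : R) :
  0 <= t -> 0 <= Num.min 1 t /\ Num.min 1 t <= 1.
Proof. by move=> t0; split; rewrite ?le_min ?ler01 ?t0 // ge_min lexx. Qed.

(** Continuous maps to the interval are plentiful enough to recover [G]:
    truncating at [1] keeps the function [d x] 1-Lipschitz, brings its values
    into the interval, and does not change which distances are small. *)
Lemma truncated_dist_continuous (R : realType) (X : Type)
    (G : set (X -> X -> R)) (d : X -> X -> R) (x : X) :
  is_gauge G -> G d ->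
  exists2 phi : X -> cube R 1,
    gauge_continuous G (@cube_gauge R 1) phi &
    forall a, cube_dist (phi x) (phi a) = Num.min 1 (d x a).
Proof.
move=> gG Gd; have [_ /(_ d Gd) [d0 dxx dC dD] _] := gG.
pose phi y : cube R 1 := fun=> Itv01 (proj1 (min1_in_i01 (d0 x y)))
                                     (proj2 (min1_in_i01 (d0 x y))).
have phiE y z : cube_dist (phi y) (phi z) =
    `|Num.min 1 (d x y) - Num.min 1 (d x z)|.
  by rewrite /cube_dist big_ord_recl big_ord0 /= max_l.
exists phi => [|a].
  apply/(cube_continuousP _ gG) => y e e0; exists d, e; split=> // z yz.
  apply: le_lt_trans yz; rewrite phiE.
  have := d0 y z; have := dD x y z; have := dD x z y; rewrite (dC z y).
  move: (d x y) (d x z) (d y z) => s t u stu tsu u0; rewrite ler_norml.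
  by case: (leP 1 s) => ?; case: (leP 1 t) => ?; apply/andP; split; lra.
rewrite phiE dxx min_r // sub0r normrN ger0_norm //.
by have [] := min1_in_i01 (d0 x a).
Qed.

Lemma beta_gauge_equivalent (R : realType) (X : Type) (G : set (X -> X -> R)) :
  is_gauge G -> topologically_equivalent (beta_gauge G) G.
Proof.
move=> gG x A; have [_ G_metric _] := gG.
have [_ H_metric _] := beta_gauge_is_gauge gG.
have nearG := @near_pointP _ _ G x A.
have nearH := @near_pointP _ _ (beta_gauge G) x A.
split=> [/nearH|nearA].
  case=> [d /H_metric [] //|A0 near]; apply/nearG => [d /G_metric [] //|].
  split=> // d Gd e e0.
  have [phi cphi phiE] := truncated_dist_continuous x gG Gd.
  have Hphi : beta_gauge G (fun y z => cube_dist (phi y) (phi z)).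
    by exists 1%N, phi.
  have [|a Aa] := near _ Hphi (Num.min 1 e); first by rewrite lt_min ltr01.
  rewrite phiE => dxa; exists a => //; move: dxa.
  rewrite lt_min !gt_min ltxx /= => /andP[d1 /orP[e1|//]].
  exact: lt_trans d1 e1.
apply/nearH => [d /H_metric [] //|].
have A0 : A !=set0 by case: nearA.
split=> // _ [n [phi [cphi ->]]] e e0.
have /near_pointP [|_ near] := cphi _ _ nearA.
  by move=> _ -> y; case: (cube_dist_metric R n).
by have [_ [a Aa <-]] := near _ erefl e e0; exists a.
Qed.

Theorem theorem15p1 (R : realType) (X : Type) (G : set (X -> X -> R)) :
  is_gauge G ->
  is_gauge (beta_gauge G)
  /\ totally_bounded (beta_gauge G)
  /\ topologically_equivalent (beta_gauge G) G.
Proof.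
move=> gG; split; first exact: beta_gauge_is_gauge.
by split; [exact: beta_gauge_totally_bounded|exact: beta_gauge_equivalent].
Qed.
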